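(* Let $G$ be a topological group, let $A$ be an abelian topological $G$-module, and let $(M,\iota_0,\iota_1,\tau)$ be a standard projective simplicial kernel of $G$, where $\tau:P\to G$. Then $H^{2}(G,A)$ is canonically isomorphic (as a group) to $Z^{1}(M,A)/\!\sim$.
   Context: Topological groups and spaces are not assumed Hausdorff. An abelian topological $G$-module is an abelian topological group $A$ (written multiplicatively, with neutral element $1$) together with a continuous action $G\times A\to A$, $(g,a)\mapsto {}^{g}a$, by group automorphisms. Cohomology (in the sense of Hu): $H^2(G,A)$ is the second cohomology group of the complex of continuous inhomogeneous cochains. That is, it is the group of continuous maps $f:G\times G\to A$ satisfying ${}^{g}f(h,k)\, f(gh,k)^{-1} f(g,hk)\, f(g,h)^{-1}=1$ for all $g,h,k\in G$, modulo the subgroup of maps of the form $(g,h)\mapsto {}^{g}c(h)\, c(gh)^{-1} c(g)$ with $c:G\to A$ continuous (pointwise multiplication). A continuous section of a continuous homomorphism $\pi:X\to Y$ is a continuous map $s:Y\to X$ (not necessarily a homomorphism) with $\pi s=\mathrm{Id}_Y$. A topological group $P$ is projective if for every continuous epimorphism (surjective homomorphism) of topological groups $\pi:B\to C$ having a continuous section, and every continuous homomorphism $f:P\to C$, there is a continuous homomorphism $g:P\to B$ with $\pi g=f$. A standard projective simplicial kernel of $G$ is a quadruple $(M,\iota_0,\iota_1,\tau)$ where $P$ is a projective topological group, $\tau:P\to G$ is a continuous (open) epimorphism which has a continuous section $s:G\to P$, $M=\{(x,y)\in P\times P : \tau(x)=\tau(y)\}$ with the subspace topology and group structure from $P\times P$,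 and $\iota_0,\iota_1:M\to P$ are the projections $\iota_0(x,y)=x$, $\iota_1(x,y)=y$. (A surjective continuous homomorphism having a continuous section is automatically open.) The module $A$ is regarded as a topological $P$-module via $\tau$ and as a topological $M$-module via $\tau\iota_0=\tau\iota_1$. For a topological group $Q$ acting continuously on $A$, $\mathrm{Der}_c(Q,A)$ denotes the abelian group (under pointwise multiplication) of continuous crossed homomorphisms, i.e. continuous maps $\alpha:Q\to A$ with $\alpha(xy)=\alpha(x)\,{}^{x}\alpha(y)$ for all $x,y\in Q$. Put $\Delta_P=\{(x,x): x\in P\}\subset M$ and $Z^{1}(M,A)=\{\alpha\in \mathrm{Der}_c(M,A) : \alpha(m)=1 \text{ for all } m\in\Delta_P\}$, a subgroup of $\mathrm{Der}_c(M,A)$. The equivalence relation $\sim$ on $Z^{1}(M,A)$ is: $\alpha\sim\beta$ if and only if there is $\gamma\in \mathrm{Der}_c(P,A)$ with $\beta(m)=\gamma(\iota_0(m))\,\gamma(\iota_1(m))^{-1}\,\alpha(m)$ for all $m\in M$. This is a congruence, so that $Z^1(M,A)/\!\sim$ is the quotient group of $Z^1(M,A)$ by the image of the homomorphism $\eta:\mathrm{Der}_c(P,A)\to Z^1(M,A)$, $\eta(\gamma)(m)=\gamma(\iota_0(m))\,\gamma(\iota_1(m))^{-1}$. *)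

(* Defs.v *)
From HB Require Import structures.
From mathcomp Require Import all_boot all_algebra all_classical.
From mathcomp Require Import topology tvs.

Set Implicit Arguments.
Unset Strict Implicit.
Unset Printing Implicit Defensive.

Import GRing.Theory.

Local Open Scope classical_set_scope.
Local Open Scope group_scope.

HB.structure Definition PreTopologicalGroup := {G of Topological G & Group G}.

HB.mixin Record PreTopologicalGroup_isTopologicalGroup G
    of PreTopologicalGroup G := {
  mulg_continuous : continuous (fun x : G * G => x.1 * x.2) ;
  invg_continuous : continuous (fun x : G => x^-1)
}.

#[short(type="topologicalGroupType")]
HB.structure Definition TopologicalGroup :=
  {G of PreTopologicalGroup G & PreTopologicalGroup_isTopologicalGroup G}.

#[short(type="topGroupHom")]
HB.structure Definition TopGroupHom (G H : topologicalGroupType) :=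
  {f of @isContinuous G H f & @UMagmaMorphism G H f}.

Definition surjective_hom (X Y : topologicalGroupType) (pi : topGroupHom X Y) :=
  forall y, exists x, pi x = y.

Definition continuous_section (X Y : topologicalGroupType)
    (pi : topGroupHom X Y) (s : Y -> X) :=
  continuous s /\ (forall y, pi (s y) = y).

Definition projective (P : topologicalGroupType) : Prop :=
  forall (B C : topologicalGroupType) (pi : topGroupHom B C),
    surjective_hom pi -> (exists s, continuous_section pi s) ->
    forall f : topGroupHom P C,
      exists g : topGroupHom P B, forall x, pi (g x) = f x.

(* Abelian topological G-modules, with the group law of A written additively:
   the neutral element is 0 and the action preserves +. *)
HB.mixin Record isTopologicalGModule (G : topologicalGroupType) A
    of TopologicalZmodule A := {
  gact : G -> A -> A ;
  gact1 : forall a, gact 1 a = a ;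
  gactM : forall g h a, gact (g * h) a = gact g (gact h a) ;
  gactD : forall g a b, gact g (a + b)%R = (gact g a + gact g b)%R ;
  gact_continuous : continuous (fun x : G * A => gact x.1 x.2)
}.

#[short(type="topologicalGModType")]
HB.structure Definition TopologicalGModule (G : topologicalGroupType) :=
  {A of TopologicalZmodule A & isTopologicalGModule G A}.

Section GactTheory.
Variables (G : topologicalGroupType) (A : topologicalGModType G).

Lemma gact0 (g : G) : gact g (0 : A)%R = 0%R.
Proof. by apply: (@addrI _ (gact g 0%R)); rewrite -gactD !addr0. Qed.

Lemma gactN (g : G) (a : A) : gact g (- a)%R = (- gact g a)%R.
Proof. by apply: (@addrI _ (gact g a)); rewrite -gactD !subrr gact0. Qed.

Lemma gactB (g : G) (a b : A) : gact g (a - b)%R = (gact g a - gact g b)%R.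
Proof. by rewrite gactD gactN. Qed.

End GactTheory.

(* The module A, with Q acting through f : Q -> G. *)
Definition res_module (Q G : topologicalGroupType) (f : topGroupHom Q G)
  (A : topologicalGModType G) : Type := A.

Section ResModule.
Variables (Q G : topologicalGroupType) (f : topGroupHom Q G).
Variable A : topologicalGModType G.

HB.instance Definition _ := TopologicalZmodule.on (res_module f A).

Definition res_act (q : Q) (a : res_module f A) : res_module f A :=
  gact (f q) (a : A).

Lemma res_act1 a : res_act 1 a = a.
Proof. by rewrite /res_act gmulf1; exact: gact1. Qed.

Lemma res_actM g h a : res_act (g * h) a = res_act g (res_act h a).
Proof. by rewrite /res_act gmulfM; exact: gactM. Qed.

Lemma res_actD g a b : res_act g (a + b)%R = (res_act g a + res_act g b)%R.
Proof. exact: (@gactD G A). Qed.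

Lemma res_act_continuous :
  continuous (fun x : Q * res_module f A => res_act x.1 x.2).
Proof.
move=> x; apply: (@continuous_comp (Q * A)%type (G * A)%type A
  (fun x => (f x.1, x.2)) (fun x => gact x.1 x.2)); last exact: gact_continuous.
apply: cvg_pair; last exact: cvg_snd.
by apply: continuous_comp; [exact: cvg_fst|exact: cts_fun].
Qed.

HB.instance Definition _ := isTopologicalGModule.Build Q (res_module f A)
  res_act1 res_actM res_actD res_act_continuous.

End ResModule.

Section ContinuousFunctions.
Variables (T : topologicalType) (A : topologicalZmodType).

Lemma continuous_fun0 : continuous (0%R : T -> A).
Proof. by move=> x; exact: cvg_cst. Qed.

Lemma continuous_funB (f g : T -> A) :
  continuous f -> continuous g -> continuous (f - g)%R.
Proof.
move=> cf cg x; apply: (@continuous_comp T (A * A)%type A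
  (fun x => (f x, g x)) (fun x => x.1 - x.2)%R); last exact: sub_continuous.
by apply: cvg_pair; [exact: cf|exact: cg].
Qed.

End ContinuousFunctions.

Section Derivations.
Variables (Q : topologicalGroupType) (A : topologicalGModType Q).

Definition crossed (a : Q -> A) : Prop :=
  continuous a /\ forall x y, a (x * y) = (a x + gact x (a y))%R.

Definition der_pred : {pred Q -> A} := fun a => `[< crossed a >].

Lemma der_pred_closed : zmod_closed der_pred.
Proof.
split=> [|a b /asboolP[ca ha] /asboolP[cb hb]]; apply/asboolP; split.
- exact: continuous_fun0.
- by move=> x y; rewrite /= gact0 addr0.
- exact: continuous_funB.
- move=> x y.
  change (a (x * y)%g - b (x * y)%g = a x - b x + gact x (a y - b y))%R.
  by rewrite ha hb gactB opprD addrACA.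
Qed.
HB.instance Definition _ := GRing.isZmodClosed.Build _ der_pred der_pred_closed.

Record der := Der { der_fun :> Q -> A ; _ : der_fun \in der_pred }.
HB.instance Definition _ := [isSub for der_fun].
HB.instance Definition _ := [Choice of der by <:].
HB.instance Definition _ := [SubChoice_isSubZmodule of der by <:].

End Derivations.

Lemma sub3ACA (V : zmodType) (x y z x' y' z' : V) :
  ((x - x') - (y - y') + (z - z') = (x - y + z) - (x' - y' + z'))%R.
Proof. by rewrite !opprD (addrACA (x - y)%R) (addrACA x). Qed.

Lemma sub2ACA (V : zmodType) (x y x' y' : V) :
  ((x - x') - (y - y') = (x - y) - (x' - y'))%R.
Proof. by rewrite !opprD addrACA. Qed.

Section Cohomology.
Variables (G : topologicalGroupType) (A : topologicalGModType G).

Definition cocycle2 (f : G * G -> A) : Prop :=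
  continuous f /\ forall g h k,
    (gact g (f (h, k)) - f ((g * h)%g, k) + f (g, (h * k)%g) - f (g, h) = 0)%R.

Definition Z2_pred : {pred G * G -> A} := fun f => `[< cocycle2 f >].

Lemma Z2_pred_closed : zmod_closed Z2_pred.
Proof.
split=> [|a b /asboolP[ca ha] /asboolP[cb hb]]; apply/asboolP; split.
- exact: continuous_fun0.
- by move=> g h k; rewrite /= gact0 !subr0 addr0.
- exact: continuous_funB.
- move=> g h k.
  change (gact g (a (h, k) - b (h, k)) - (a ((g * h)%g, k) - b ((g * h)%g, k))
    + (a (g, (h * k)%g) - b (g, (h * k)%g)) - (a (g, h) - b (g, h)) = 0)%R.
  rewrite -[RHS](subrr 0%R) -{1}(ha g h k) -(hb g h k) gactB.
  by rewrite sub3ACA sub2ACA.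
Qed.
HB.instance Definition _ := GRing.isZmodClosed.Build _ Z2_pred Z2_pred_closed.

Record Z2 := MkZ2 { Z2_fun :> G * G -> A ; _ : Z2_fun \in Z2_pred }.
HB.instance Definition _ := [isSub for Z2_fun].
HB.instance Definition _ := [Choice of Z2 by <:].
HB.instance Definition _ := [SubChoice_isSubZmodule of Z2 by <:].

Definition coboundary2 (f : G * G -> A) : Prop :=
  exists2 c : G -> A, continuous c &
    forall g h, f (g, h) = (gact g (c h) - c (g * h)%g + c g)%R.

Definition B2_pred : {pred Z2} := fun f => `[< coboundary2 f >].

Lemma B2_pred_closed : zmod_closed B2_pred.
Proof.
split=> [|a b /asboolP[c cc hc] /asboolP[d cd hd]]; apply/asboolP.
- exists 0%R; first exact: continuous_fun0.
  by move=> g h; rewrite /= gact0 subr0 addr0.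
- exists (c - d)%R; first exact: continuous_funB.
  move=> g h.
  change (a (g, h) - b (g, h) =
    gact g (c h - d h) - (c (g * h)%g - d (g * h)%g) + (c g - d g))%R.
  by rewrite hc hd gactB sub3ACA.
Qed.
HB.instance Definition _ := GRing.isZmodClosed.Build _ B2_pred B2_pred_closed.

Definition H2 : zmodType := Quotient.quot B2_pred.

Definition H2_class (f : Z2) : H2 := \pi_(Quotient.quot B2_pred)%qT f.

End Cohomology.

Lemma continuous_pair (T X Y : topologicalType) (u : T -> X) (v : T -> Y) :
  continuous u -> continuous v -> continuous (fun t => (u t, v t)).
Proof. by move=> cu cv t; apply: cvg_pair; [exact: cu|exact: cv]. Qed.

(* M = {(x, y) | tau x = tau y}; set_type carries the subspace topology. *)
Section SimplicialKernel.
Variables (P G : topologicalGroupType) (tau : topGroupHom P G).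

Definition skernel_set : set (P * P) := [set p | tau p.1 = tau p.2].
Definition skernel : Type := set_type skernel_set.

HB.instance Definition _ := SubType.on skernel.
HB.instance Definition _ := Choice.on skernel.
HB.instance Definition _ := Topological.on skernel.

Lemma skernel_closed :
  group_closed (fun p : P * P => p \in skernel_set).
Proof.
split; first by rewrite inE.
move=> p q; rewrite !inE /skernel_set /= => hp hq.
rewrite [LHS]gmulfM [RHS]gmulfM !gmulfV.
by congr (_ * _^-1).
Qed.
HB.instance Definition _ :=
  SubChoice_isSubGroup.Build _ _ skernel skernel_closed.

Lemma skernel_val_continuous : continuous (val : skernel -> P * P).
Proof. exact: initial_continuous. Qed.

Lemma skernel_continuousP (T : topologicalType) (f : T -> skernel) :
  continuous (fun t => val (f t)) -> continuous f.
Proof.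
move=> cf; apply/continuousP => _ [B oB <-].
by move/continuousP : cf => /(_ _ oB).
Qed.

Definition iota0 (m : skernel) : P := (val m).1.
Definition iota1 (m : skernel) : P := (val m).2.

Lemma iota0_continuous : continuous iota0.
Proof.
by move=> m; apply: continuous_comp; [exact: skernel_val_continuous|exact: cvg_fst].
Qed.

Lemma iota1_continuous : continuous iota1.
Proof.
by move=> m; apply: continuous_comp; [exact: skernel_val_continuous|exact: cvg_snd].
Qed.

Lemma iota0_monoid_morphism : monoid.monoid_morphism iota0.
Proof. by split=> [|x y]; rewrite /iota0 ?val1 ?valM. Qed.

Lemma iota1_monoid_morphism : monoid.monoid_morphism iota1.
Proof. by split=> [|x y]; rewrite /iota1 ?val1 ?valM. Qed.

Lemma skernel_mul_continuous :
  continuous (fun x : skernel * skernel => x.1 * x.2).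
Proof.
have c (i : skernel -> P) : continuous i -> continuous
    (fun x : skernel * skernel => i x.1 * i x.2).
  move=> ci x; apply: (@continuous_comp _ (P * P)%type P
    (fun x : skernel * skernel => (i x.1, i x.2)) (fun x => x.1 * x.2));
    last exact: mulg_continuous.
  apply: cvg_pair; apply: continuous_comp; try exact: ci.
    exact: cvg_fst.
  exact: cvg_snd.
apply: skernel_continuousP => x.
rewrite (_ : (fun _ => _) =
  fun t => (iota0 t.1 * iota0 t.2, iota1 t.1 * iota1 t.2)); last first.
  by apply/funext => t; rewrite valM.
move: x; apply: continuous_pair.
  exact: (c _ iota0_continuous).
exact: (c _ iota1_continuous).
Qed.

Lemma skernel_inv_continuous : continuous (fun x : skernel => x^-1).
Proof.
have c (i : skernel -> P) : continuous i -> continuous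
    (fun x : skernel => (i x)^-1).
  by move=> ci x; apply: continuous_comp; [exact: ci|exact: invg_continuous].
apply: skernel_continuousP => x.
rewrite (_ : (fun _ => _) = fun t => ((iota0 t)^-1, (iota1 t)^-1)); last first.
  by apply/funext => t; rewrite gmulfV.
move: x; apply: continuous_pair.
  exact: (c _ iota0_continuous).
exact: (c _ iota1_continuous).
Qed.

HB.instance Definition _ := PreTopologicalGroup_isTopologicalGroup.Build skernel
  skernel_mul_continuous skernel_inv_continuous.

HB.instance Definition _ := isContinuous.Build _ _ iota0 iota0_continuous.
HB.instance Definition _ := isContinuous.Build _ _ iota1 iota1_continuous.
HB.instance Definition _ :=
  isUMagmaMorphism.Build _ _ iota0 iota0_monoid_morphism.
HB.instance Definition _ :=
  isUMagmaMorphism.Build _ _ iota1 iota1_monoid_morphism.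

End SimplicialKernel.

Definition standard_projective_skernel (P G : topologicalGroupType)
    (tau : topGroupHom P G) : Prop :=
  [/\ projective P, surjective_hom tau & exists s, continuous_section tau s].

Section Z1.
Variables (P G : topologicalGroupType) (tau : topGroupHom P G).
Variable A : topologicalGModType G.

Definition P_module : topologicalGModType P := res_module tau A.
Definition M_module : topologicalGModType (skernel tau) :=
  res_module (@iota0 P G tau) P_module.

Definition Delta : set (skernel tau) := [set m | exists x, val m = (x, x)].

Definition Z1_pred : {pred der M_module} :=
  fun a => `[< forall m, Delta m -> a m = 0%R >].

Lemma Z1_pred_closed : zmod_closed Z1_pred.
Proof.
split=> [|a b /asboolP ha /asboolP hb]; apply/asboolP => m hm //.
by change (a m - b m = 0)%R; rewrite (ha m hm) (hb m hm) subrr.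
Qed.
HB.instance Definition _ := GRing.isZmodClosed.Build _ Z1_pred Z1_pred_closed.

Record Z1 := MkZ1 { Z1_der :> der M_module ; _ : Z1_der \in Z1_pred }.
HB.instance Definition _ := [isSub for Z1_der].
HB.instance Definition _ := [Choice of Z1 by <:].
HB.instance Definition _ := [SubChoice_isSubZmodule of Z1 by <:].

Definition Z1_sim (a b : Z1) : Prop :=
  exists c : der P_module,
    forall m, (b m = c (iota0 m) - c (iota1 m) + a m)%R.

Definition eta_image : {pred Z1} := fun a =>
  `[< exists c : der P_module, forall m, (a m = c (iota0 m) - c (iota1 m))%R >].

Lemma eta_image_closed : zmod_closed eta_image.
Proof.
split=> [|a b /asboolP[c hc] /asboolP[d hd]]; apply/asboolP.
  by exists 0%R => m; change (0 = 0 - 0 :> A)%R; rewrite subr0.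
exists (c - d)%R => m.
change (a m - b m = (c (iota0 m) - d (iota0 m)) - (c (iota1 m) - d (iota1 m)))%R.
by rewrite hc hd sub2ACA.
Qed.
HB.instance Definition _ :=
  GRing.isZmodClosed.Build _ eta_image eta_image_closed.

Definition Z1_quot : zmodType := Quotient.quot eta_image.

Definition Z1_class (a : Z1) : Z1_quot := \pi_(Quotient.quot eta_image)%qT a.

Lemma Z1_classP (a b : Z1) : Z1_class a = Z1_class b <-> Z1_sim a b.
Proof.
rewrite /Z1_class; split=> [ab|[c hc]].
  have /eqP : b = a %[mod Quotient.quot eta_image]%qT by [].
  rewrite -Quotient.idealrBE => /asboolP[c hc]; exists c => m.
  by rewrite -hc; change (b m = b m - a m + a m)%R; rewrite subrK.
apply/esym/eqP; rewrite -Quotient.idealrBE; apply/asboolP; exists c => m.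
by change (b m - a m = c (iota0 m) - c (iota1 m))%R; rewrite hc addrK.
Qed.

End Z1.

Lemma section_pair_subproof (P G : topologicalGroupType) (tau : topGroupHom P G)
    (s : G -> P) (hs : continuous_section tau s) (g h : G) :
  (s g * s h, s (g * h)) \in skernel_set tau.
Proof.
apply/mem_set; rewrite /skernel_set /= [LHS]gmulfM [RHS]hs.2.
by congr (_ * _); exact: hs.2.
Qed.

Definition section_pair (P G : topologicalGroupType) (tau : topGroupHom P G)
    (s : G -> P) (hs : continuous_section tau s) (g h : G) : skernel tau :=
  Sub (s g * s h, s (g * h)) (section_pair_subproof hs g h).

(* Main.v *)
Require Import Defs.
From HB Require Import structures.
From mathcomp Require Import all_boot all_algebra all_classical.
From mathcomp Require Import topology tvs.

(** Why the theorem is true.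

    A crossed homomorphism [a] on the kernel pair M that vanishes on the
    diagonal behaves like a difference of a function at two points of one fibre
    of [tau]: it is additive along chains, [a (x, z) = a (x, y) + a (y, z)]
    (Z1_trans), equivariant under left translation by P (Z1_mull) and invariant
    under right translation (Z1_mulr).  A continuous section [s] of [tau] fails
    to be multiplicative exactly by the pairs [(s g * s h, s (g * h))] of M, and
    evaluating [a] on them gives a continuous 2-cocycle of G (section_cocycle).
    The class of this cocycle does not depend on [s]: the values
    [a (s' g, s g)] cobound the difference (section_cocycle_indep).

    The homomorphism from Z1 to H2 obtained in this way has kernel the image of
    eta.  If [a (x, y) = c x - c y], then [c \o s] cobounds the cocycle
    (section_cocycle_eta).  Conversely, if [d] cobounds it, then
    [x |-> a (x, s (tau x)) + d (tau x)] is a crossed homomorphism on P whose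
    image under eta is [a] (section_cocycle_trivial).

    It is also surjective (section_cocycle_surjective), and this is where P has
    to be projective.  A continuous 2-cocycle [f] defines a topological group
    structure on A * G, whose projection to G has the continuous section
    [g |-> (0, g)].  Lifting [tau] to this extension gives a continuous
    [c : P -> A] whose coboundary is, up to sign, the pullback of [f] along
    [tau] (projective_cobounds_pullback).  On M the contributions of [f] at the
    two projections agree, so [(x, y) |-> c x - c y] is a crossed homomorphism;
    its cocycle differs from [f] by the coboundary of [c \o s].

    The isomorphism of the theorem is the inverse of the one that the first
    isomorphism theorem provides (quot_iso_of_surjective). *)

Set Implicit Arguments.
Unset Strict Implicit.
Unset Printing Implicit Defensive.

Import GRing.Theory.

Local Open Scope ring_scope.
Local Open Scope group_scope.

(** * The first isomorphism theorem for abelian groups *)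

(** The isomorphism is oriented from the target [W] to the quotient, with its
    value on [psi u] prescribed; this determines it, as [psi] is onto. *)
Lemma quot_iso_of_surjective (U W : zmodType) (I : zmodClosed U)
    (psi : {additive U -> W}) :
  (forall w, exists u, psi u = w) -> (forall u, u \in I <-> psi u = 0%R) ->
  exists phi : {additive W -> Quotient.quot I},
    bijective phi /\ forall u, phi (psi u) = \pi_(Quotient.quot I)%qT u.
Proof.
move=> surj ker.
have piE u v : (\pi_(Quotient.quot I) u = \pi_(Quotient.quot I) v)%qT <->
    psi u = psi v.
  split=> [/eqP|uv].
    by rewrite -Quotient.idealrBE => /ker; rewrite raddfB => /subr0_eq.
  apply/eqP; rewrite -Quotient.idealrBE; apply/ker.
  by rewrite raddfB uv subrr.
have [r rK] := choice surj.
pose p (w : W) : Quotient.quot I := (\pi_(Quotient.quot I) (r w))%qT.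
have pP u : p (psi u) = (\pi_(Quotient.quot I) u)%qT by apply/piE; rewrite rK.
have pB : GRing.zmod_morphism p.
  move=> v w; rewrite /p -raddfB /=.
  by apply/piE; rewrite raddfB !rK.
pose pM := GRing.isZmodMorphism.Build _ _ p pB.
pose phi : {additive W -> Quotient.quot I} := HB.pack p pM.
exists phi; split=> //.
exists (fun q => psi (repr q)) => [w|q].
  by rewrite -[RHS]rK; apply/piE; rewrite reprK.
by rewrite [LHS]pP reprK.
Qed.

(** * Continuity of pointwise operations *)

Section Continuity.
Variables (T : topologicalType).

Lemma continuous_addr (A : topologicalZmodType) (u v : T -> A) :
  continuous u -> continuous v -> continuous (fun t => u t + v t)%R.
Proof.
move=> cu cv t; apply: (@continuous_comp T (A * A)%type A
  (fun t => (u t, v t)) (fun x => x.1 + x.2)%R); last exact: add_continuous.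
exact: continuous_pair.
Qed.

Lemma continuous_mulg (Q : topologicalGroupType) (u v : T -> Q) :
  continuous u -> continuous v -> continuous (fun t => u t * v t).
Proof.
move=> cu cv t; apply: (@continuous_comp T (Q * Q)%type Q
  (fun t => (u t, v t)) (fun x => x.1 * x.2)); last exact: mulg_continuous.
exact: continuous_pair.
Qed.

Lemma continuous_gact (Q : topologicalGroupType) (A : topologicalGModType Q)
    (u : T -> Q) (v : T -> A) :
  continuous u -> continuous v -> continuous (fun t => gact (u t) (v t)).
Proof.
move=> cu cv t; apply: (@continuous_comp T (Q * A)%type A
  (fun t => (u t, v t)) (fun x => gact x.1 x.2)); last exact: gact_continuous.
exact: continuous_pair.
Qed.

Lemma continuous_comp_fun (X Y : topologicalType) (u : T -> X) (v : X -> Y) :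
  continuous u -> continuous v -> continuous (fun t => v (u t)).
Proof. by move=> cu cv t; apply: continuous_comp; [exact: cu|exact: cv]. Qed.

End Continuity.

(** * The topological group extension defined by a 2-cocycle *)

Section CocycleExtension.
Variables (G : topologicalGroupType) (A : topologicalGModType G) (f : Z2 A).

Lemma Z2_continuous : continuous f.
Proof. by have /asboolP[] := valP f. Qed.

Lemma Z2_cocycleE g h k :
  (gact g (f (h, k)) + f (g, (h * k)%g) = f (g, h) + f ((g * h)%g, k))%R.
Proof.
have /asboolP[_ /(_ g h k)/subr0_eq fE] := valP f.
by rewrite -[f (g, h)]fE addrAC subrK.
Qed.

(** Cocycles are not assumed normalized; the defect of normalization is
    governed by the single value [f (1, 1)], which therefore enters the neutral
    element and the inverse of the extension. *)
Lemma Z2_1g g : f (1, g) = f (1, 1).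
Proof.
by have := Z2_cocycleE 1 1 g; rewrite gact1 !mul1g => /addIr.
Qed.

Lemma Z2_g1 g : f (g, 1) = gact g (f (1, 1)).
Proof.
by have := Z2_cocycleE g 1 1; rewrite !mulg1 => /addIr/esym.
Qed.

(** A synonym of A * G: it keeps the product topology, but must not inherit the
    direct product group law. *)
Definition cocycle_ext : Type := (A * G)%type.

HB.instance Definition _ := Topological.on cocycle_ext.

Definition ext_mul (x y : cocycle_ext) : cocycle_ext :=
  ((x.1 + gact x.2 y.1 + f (x.2, y.2))%R, x.2 * y.2).

Definition ext_one : cocycle_ext := ((- f (1%g, 1%g))%R, 1).

Definition ext_inv (x : cocycle_ext) : cocycle_ext :=
  ((- f (1%g, 1%g) - (gact x.2^-1%g x.1 + f (x.2^-1%g, x.2)))%R, x.2^-1).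

Lemma ext_mulA : associative ext_mul.
Proof.
move=> [a g] [b h] [c k]; congr pair; rewrite /= ?mulgA //.
rewrite !gactD gactM -!addrA Z2_cocycleE; congr (_ + (_ + _))%R.
by rewrite addrCA.
Qed.

Lemma ext_mul1g : left_id ext_one ext_mul.
Proof.
move=> [a g]; congr pair; rewrite /= ?mul1g //.
by rewrite gact1 (Z2_1g g) addrAC addNr add0r.
Qed.

Lemma ext_mulg1 : right_id ext_one ext_mul.
Proof.
move=> [a g]; congr pair; rewrite /= ?mulg1 //.
by rewrite gactN (Z2_g1 g) subrK.
Qed.

Lemma ext_mulVg : left_inverse ext_one ext_inv ext_mul.
Proof.
move=> [a g]; congr pair; rewrite /= ?mulVg //.
by rewrite -addrA subrK.
Qed.

Lemma ext_mulgV : right_inverse ext_one ext_inv ext_mul.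
Proof.
move=> [a g]; congr pair; rewrite /= ?mulgV //.
have := Z2_cocycleE g g^-1 g; rewrite mulVg mulgV (Z2_g1 g) (Z2_1g g) => fE.
apply: (@addIr _ (f (1, 1))); rewrite addNr -addrA -fE.
rewrite !(gactN, gactD) -gactM mulgV gact1.
rewrite -opprD (addrCA _ a) opprD addNKr.
by rewrite [X in (- X + _)%R]addrC addNr.
Qed.

HB.instance Definition _ := isGroup.Build cocycle_ext
  ext_mulA ext_mul1g ext_mulg1 ext_mulVg ext_mulgV.

Let continuous_1 : continuous (fun x : cocycle_ext => x.1).
Proof. by move=> x; exact: cvg_fst. Qed.

Let continuous_2 : continuous (fun x : cocycle_ext => x.2).
Proof. by move=> x; exact: cvg_snd. Qed.

Lemma ext_mul_continuous :
  continuous (fun x : cocycle_ext * cocycle_ext => x.1 * x.2).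
Proof.
have c1 : continuous (fun x : cocycle_ext * cocycle_ext => x.1).
  by move=> x; exact: cvg_fst.
have c2 : continuous (fun x : cocycle_ext * cocycle_ext => x.2).
  by move=> x; exact: cvg_snd.
have [c11 c12] := (continuous_comp_fun c1 continuous_1,
                   continuous_comp_fun c1 continuous_2).
have [c21 c22] := (continuous_comp_fun c2 continuous_1,
                   continuous_comp_fun c2 continuous_2).
apply: continuous_pair; last exact: continuous_mulg.
apply: continuous_addr.
  by apply: continuous_addr => //; exact: continuous_gact.
by apply: continuous_comp_fun Z2_continuous; exact: continuous_pair.
Qed.

Lemma ext_inv_continuous : continuous (fun x : cocycle_ext => x^-1).
Proof.
have cV : continuous (fun x : cocycle_ext => x.2^-1).
  exact: continuous_comp_fun (@invg_continuous G).
apply: continuous_pair => //.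
apply: continuous_funB; first by move=> x; exact: cvg_cst.
apply: continuous_addr; first exact: continuous_gact.
by apply: continuous_comp_fun Z2_continuous; exact: continuous_pair.
Qed.

HB.instance Definition _ := PreTopologicalGroup_isTopologicalGroup.Build
  cocycle_ext ext_mul_continuous ext_inv_continuous.

Definition ext_proj (x : cocycle_ext) : G := x.2.

Lemma ext_proj_monoid_morphism : monoid.monoid_morphism ext_proj.
Proof. by []. Qed.

HB.instance Definition _ := isContinuous.Build _ _ ext_proj continuous_2.
HB.instance Definition _ :=
  isUMagmaMorphism.Build _ _ ext_proj ext_proj_monoid_morphism.

(** The second component of a lift of [tau] to the extension is [tau] itself, so
    multiplicativity of the lift is an equation on its first component [c]. *)
Lemma projective_cobounds_pullback (P : topologicalGroupType)
    (tau : topGroupHom P G) : projective P ->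
  exists2 c : P -> A, continuous c & forall x y,
    c (x * y) = (c x + gact (tau x) (c y) + f (tau x, tau y))%R.
Proof.
move=> projP.
have [|| l lE] := projP cocycle_ext G ext_proj _ _ tau.
- by move=> g; exists (0%R, g).
- exists (fun g => (0%R, g)); split=> //.
  by apply: continuous_pair => g; [exact: cvg_cst|exact: cvg_id].
exists (fun x => (l x).1) => [|x y].
  by apply: continuous_comp_fun continuous_1; exact: cts_fun.
by rewrite gmulfM -!lE.
Qed.

End CocycleExtension.

(** * Crossed homomorphisms vanishing on the diagonal *)

Section KernelDerivations.
Variables (G : topologicalGroupType) (A : topologicalGModType G).
Variables (P : topologicalGroupType) (tau : topGroupHom P G).
Implicit Types (a : Z1 tau A) (x y z : P).

Let tauM x y : tau (x * y) = tau x * tau y.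
Proof. exact: gmulfM. Qed.

Lemma mem_skernel x y : tau x = tau y -> (x, y) \in skernel_set tau.
Proof. by move=> e; apply/mem_set. Qed.

Definition skernel_pair x y (e : tau x = tau y) : skernel tau :=
  Sub (x, y) (mem_skernel e).

Lemma skernel_iotaP (m : skernel tau) : tau (iota0 m) = tau (iota1 m).
Proof. exact: (set_mem (valP m)). Qed.

Lemma skernel_pair_continuous (T : topologicalType) (u v : T -> P)
    (e : forall t, tau (u t) = tau (v t)) :
  continuous u -> continuous v -> continuous (fun t => skernel_pair (e t)).
Proof.
by move=> cu cv; apply: skernel_continuousP; exact: continuous_pair.
Qed.

(** Evaluation of [a] on a pair of points of one fibre, typed in A itself rather
    than in its restriction to M, so that all values live in one module. *)
Definition Z1_val a x y (e : tau x = tau y) : A := a (skernel_pair e).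

Lemma Z1_val_iota a m : Z1_val a (skernel_iotaP m) = a m.
Proof.
by rewrite /Z1_val; congr (a _); apply: val_inj; rewrite SubK -surjective_pairing.
Qed.

Lemma eq_Z1_val a x y x' y' (e : tau x = tau y) (e' : tau x' = tau y') :
  x = x' -> y = y' -> Z1_val a e = Z1_val a e'.
Proof. by move=> xx' yy'; subst; congr Z1_val; exact: Prop_irrelevance. Qed.

Lemma Z1_continuous a : continuous a.
Proof. by have /asboolP[] := valP (val a). Qed.

Lemma Z1_crossed a (m n : skernel tau) :
  (a (m * n)%g : A) = (a m + gact (tau (iota0 m)) (a n : A))%R.
Proof. by have /asboolP[_] := valP (val a); apply. Qed.

Lemma Z1_diag a x (e : tau x = tau x) : Z1_val a e = 0%R.
Proof. by have /asboolP := valP a; apply; exists x. Qed.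

Lemma Z1_mul a x y x' y' (e : tau x = tau y) (e' : tau x' = tau y')
    (e'' : tau (x * x') = tau (y * y')) :
  Z1_val a e'' = (Z1_val a e + gact (tau x) (Z1_val a e'))%R.
Proof. by rewrite -[RHS]Z1_crossed /Z1_val; congr (a _); exact: val_inj. Qed.

Lemma Z1_mull a x y z (e : tau y = tau z) (e' : tau (x * y) = tau (x * z)) :
  Z1_val a e' = gact (tau x) (Z1_val a e).
Proof. by rewrite (Z1_mul a (erefl (tau x)) e) Z1_diag add0r. Qed.

Lemma Z1_mulr a x y z (e : tau x = tau y) (e' : tau (x * z) = tau (y * z)) :
  Z1_val a e' = Z1_val a e.
Proof. by rewrite (Z1_mul a e (erefl (tau z))) Z1_diag gact0 addr0. Qed.

(** In M, [(x, z) = (x * y^-1, 1) * (y, z)], the element [x * y^-1] acts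
    trivially on A, and [(x * y^-1, 1)] is a right translate of [(x, y)]. *)
Lemma Z1_trans a x y z (e : tau x = tau y) (e' : tau y = tau z)
    (e'' : tau x = tau z) :
  Z1_val a e'' = (Z1_val a e + Z1_val a e')%R.
Proof.
have d : tau (x * y^-1) = tau (y * y^-1) by rewrite !tauM e.
have dE : tau (x * y^-1) = 1 by rewrite d mulgV gmulf1.
have e2 : tau (x * y^-1 * y) = tau (y * y^-1 * z) by rewrite mulgVK mulgV mul1g.
have := Z1_mul a d e' e2; rewrite dE gact1 (Z1_mulr a e d) => <-.
by apply: eq_Z1_val; rewrite ?mulgVK ?mulgV ?mul1g.
Qed.

Lemma Z1_val_continuous a (T : topologicalType) (u v : T -> P)
    (e : forall t, tau (u t) = tau (v t)) :
  continuous u -> continuous v -> continuous (fun t => Z1_val a (e t)).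
Proof.
move=> cu cv; apply: (@continuous_comp_fun T _ A); last exact: Z1_continuous.
exact: skernel_pair_continuous.
Qed.

(** * The cocycle attached to a continuous section *)

Section SectionCocycle.
Variables (s : G -> P) (hs : continuous_section tau s).

Let s_continuous : continuous s := hs.1.
Let sK g : tau (s g) = g := hs.2 g.

Lemma tau_sectionM g h : tau (s g * s h) = tau (s (g * h)).
Proof. by rewrite tauM !sK. Qed.

Definition section_cocycle_fun a (p : G * G) : A :=
  a (section_pair hs p.1 p.2).

Lemma section_cocycle_funE a g h :
  section_cocycle_fun a (g, h) = Z1_val a (tau_sectionM g h).
Proof. by rewrite /section_cocycle_fun /Z1_val; congr (a _); exact: val_inj. Qed.

(** The cocycle identity compares the two ways to go from [s g * s h * s k] to
    [s (g * h * k)] inside one fibre: through [s g * s (h * k)] and through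
    [s (g * h) * s k]. *)
Lemma section_cocycle_subproof a : section_cocycle_fun a \in Z2_pred (A := A).
Proof.
apply/asboolP; split=> [|g h k].
  rewrite (_ : section_cocycle_fun a =
    fun p => Z1_val a (tau_sectionM p.1 p.2)); last first.
    by apply/funext => -[g h]; exact: section_cocycle_funE.
  apply: (@Z1_val_continuous a (G * G)%type (fun p => s p.1 * s p.2)
    (fun p => s (p.1 * p.2)) (fun p => tau_sectionM p.1 p.2)).
    by apply: continuous_mulg; apply: continuous_comp_fun s_continuous => p;
      [exact: cvg_fst|exact: cvg_snd].
  exact: continuous_comp_fun (@mulg_continuous G) s_continuous.
rewrite !section_cocycle_funE.
have e1 : tau (s g * (s h * s k)) = tau (s g * s (h * k)).
  by rewrite !tauM !sK.
have e2 : tau (s g * s h * s k) = tau (s (g * h) * s k).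
  by rewrite !tauM !sK.
have e3 : tau (s g * (s h * s k)) = tau (s (g * (h * k))).
  by rewrite !tauM !sK.
have e4 : tau (s g * s h * s k) = tau (s (g * h * k)).
  by rewrite !tauM !sK.
have E1 := Z1_mull a (tau_sectionM h k) e1.
have E2 := Z1_mulr a (tau_sectionM g h) e2.
have E3 := Z1_trans a e1 (tau_sectionM g (h * k)) e3.
have E4 := Z1_trans a e2 (tau_sectionM (g * h) k) e4.
have E : Z1_val a e3 = Z1_val a e4.
  by apply: eq_Z1_val; rewrite !mulgA.
rewrite sK in E1; rewrite -E1 -E2 (addrAC (Z1_val a e1)) -E3 E E4.
by rewrite addrK subrr.
Qed.

Definition section_cocycle a : Z2 A := MkZ2 (section_cocycle_subproof a).

Lemma section_cocycleE a g h :
  section_cocycle a (g, h) = Z1_val a (tau_sectionM g h).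
Proof. exact: section_cocycle_funE. Qed.

Lemma section_cocycle_is_zmod_morphism : GRing.zmod_morphism section_cocycle.
Proof. by move=> a b; apply: val_inj. Qed.

HB.instance Definition _ := GRing.isZmodMorphism.Build _ _ section_cocycle
  section_cocycle_is_zmod_morphism.

Lemma section_cocycle_eta a (c : der (P_module tau A)) :
  (forall m, a m = (c (iota0 m) - c (iota1 m))%R) ->
  coboundary2 (section_cocycle a).
Proof.
have /asboolP[cc cM] := valP c.
move=> ac; exists (fun g => c (s g) : A).
  exact: (@continuous_comp_fun G P A).
move=> g h; rewrite section_cocycleE.
have -> : Z1_val a (tau_sectionM g h) = (c (s g * s h)%g - c (s (g * h)%g))%R.
  exact: ac.
rewrite cM addrC [RHS]addrC addrCA; congr (_ + _)%R.
by rewrite addrC; congr (gact _ _ - _)%R; exact: sK.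
Qed.

Lemma tau_section x : tau x = tau (s (tau x)).
Proof. by rewrite sK. Qed.

(** The primitive [x |-> a (x, s (tau x))] of [a] is a crossed homomorphism only
    up to the cocycle of [a]; adding [d \o tau] corrects the error, and changes
    nothing in differences along a fibre. *)
Lemma section_cocycle_trivial a : coboundary2 (section_cocycle a) ->
  exists c : der (P_module tau A),
    forall m, a m = (c (iota0 m) - c (iota1 m))%R.
Proof.
case=> d dc dE.
pose c x : P_module tau A := (Z1_val a (tau_section x) + d (tau x))%R.
have cP : c \in der_pred (A := P_module tau A).
  apply/asboolP; split=> [|x y].
    have ct : continuous tau by exact: cts_fun.
    apply: (@continuous_addr P A); last exact: (@continuous_comp_fun P G A).
    apply: (@Z1_val_continuous a P id (fun x => s (tau x)) tau_section).
      by move=> x; exact: cvg_id.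
    exact: continuous_comp_fun s_continuous.
  change (c (x * y)%g = c x + gact (tau x) (c y))%R.
  have e1 : tau (x * y) = tau (s (tau x) * s (tau y)) by rewrite !tauM !sK.
  have e2 : tau (s (tau x) * s (tau y)) = tau (s (tau (x * y))).
    by rewrite sK -e1.
  rewrite /c (Z1_trans a e1 e2) (Z1_mul a (tau_section x) (tau_section y)).
  have -> : Z1_val a e2 = section_cocycle a (tau x, tau y).
    by rewrite section_cocycleE; apply: eq_Z1_val; rewrite ?tauM.
  rewrite dE tauM gactD -!addrA; congr (_ + _)%R.
  rewrite [RHS]addrCA; congr (_ + _)%R.
  by rewrite [RHS]addrC [(d (tau x) + d _)%R]addrC addKr.
exists (Der cP) => m.
rewrite -Z1_val_iota.
change (Z1_val a (skernel_iotaP m) = c (iota0 m) - c (iota1 m))%R.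
rewrite /c [d (tau (iota0 m))](congr1 d (skernel_iotaP m)).
rewrite opprD addrACA subrr addr0.
have e : tau (iota0 m) = tau (s (tau (iota1 m))) by rewrite sK skernel_iotaP.
rewrite -(_ : Z1_val a e = Z1_val a (tau_section (iota0 m))).
  by rewrite (Z1_trans a (skernel_iotaP m) (tau_section (iota1 m)) e) addrK.
by apply: eq_Z1_val; rewrite ?skernel_iotaP.
Qed.

(** [c (s g * s h) - c (s (g * h))] is [f (g, h)] plus the coboundary of
    [c \o s], by the equation that [c] satisfies. *)
Lemma section_cocycle_surjective (f : Z2 A) : projective P ->
  exists a, coboundary2 (section_cocycle a - f)%R.
Proof.
move=> /(projective_cobounds_pullback f tau)[c cc cM].
pose a (m : skernel tau) : M_module tau A := (c (iota0 m) - c (iota1 m))%R.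
have aP : a \in der_pred (A := M_module tau A).
  apply/asboolP; split=> [|m n].
    apply: (@continuous_funB _ A (fun m : skernel tau => c (iota0 m))
      (fun m => c (iota1 m))); apply: continuous_comp_fun cc.
      exact: iota0_continuous.
    exact: iota1_continuous.
  change (c (iota0 (m * n)%g) - c (iota1 (m * n)%g) = c (iota0 m) -
    c (iota1 m) + gact (tau (iota0 m)) (c (iota0 n) - c (iota1 n)))%R.
  have -> : iota0 (m * n) = iota0 m * iota0 n by exact: gmulfM.
  have -> : iota1 (m * n) = iota1 m * iota1 n by exact: gmulfM.
  rewrite !cM !skernel_iotaP.
  by rewrite [X in (_ - X)%R]addrC opprD addrA addrK gactB opprD addrACA.
have aZ : Der aP \in Z1_pred (A := A).
  apply/asboolP => m [x mx].
  change (c (val m).1 - c (val m).2 = 0)%R.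
  by rewrite mx subrr.
exists (MkZ1 aZ), (fun g => c (s g)); first exact: continuous_comp_fun cc.
move=> g h.
change (c (s g * s h)%g - c (s (g * h)%g) - f (g, h) =
  gact g (c (s h)) - c (s (g * h)%g) + c (s g))%R.
by rewrite cM !sK addrAC addrK [RHS]addrAC [(c (s g) + _)%R]addrC.
Qed.

End SectionCocycle.

(** The fibre over [g * h] contains two chains from [s' g * s' h] to
    [s (g * h)], through [s g * s h] and through [s' (g * h)]; equating the sums
    of [a] along them relates the two cocycles. *)
Lemma section_cocycle_indep s s' (hs : continuous_section tau s)
    (hs' : continuous_section tau s') a :
  coboundary2 (section_cocycle hs' a - section_cocycle hs a)%R.
Proof.
have [[cs sK] [cs' s'K]] := (hs, hs').
have ss' g : tau (s' g) = tau (s g) by rewrite sK s'K.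
exists (fun g => Z1_val a (ss' g)); first exact: Z1_val_continuous.
move=> g h.
change (section_cocycle hs' a (g, h) - section_cocycle hs a (g, h) =
  gact g (Z1_val a (ss' h)) - Z1_val a (ss' (g * h)%g) + Z1_val a (ss' g))%R.
rewrite !section_cocycleE.
have e1 : tau (s' g * s' h) = tau (s g * s h) by rewrite !tauM !ss'.
have e2 : tau (s' g * s' h) = tau (s (g * h)) by rewrite tauM !s'K sK.
have E := Z1_trans a e1 (tau_sectionM hs g h) e2.
rewrite (Z1_trans a (tau_sectionM hs' g h) (ss' (g * h)) e2) in E.
rewrite (Z1_mul a (ss' g) (ss' h)) s'K in E.
apply: (@addIr _ (Z1_val a (tau_sectionM hs g h))); rewrite subrK.
apply: (@addIr _ (Z1_val a (ss' (g * h)))).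
rewrite E [RHS]addrAC; congr (_ + _)%R.
by rewrite [RHS]addrAC subrK addrC.
Qed.

End KernelDerivations.

(** * The isomorphism *)

Lemma H2_class_eq (G : topologicalGroupType) (A : topologicalGModType G)
    (u v : Z2 A) :
  H2_class u = H2_class v <-> coboundary2 (u - v)%R.
Proof.
split=> [/eqP|uv].
  by rewrite -Quotient.idealrBE => /asboolP.
by apply/eqP; rewrite -Quotient.idealrBE; apply/asboolP.
Qed.

Theorem theorem3p1 (G : topologicalGroupType) (A : topologicalGModType G)
    (P : topologicalGroupType) (tau : topGroupHom P G)
    (htau : standard_projective_skernel tau) :
  exists phi : {additive H2 A -> Z1_quot tau A},
    bijective phi /\
    forall (s : G -> P) (hs : continuous_section tau s) (a : Z1 tau A),
      exists f : Z2 A,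
        (forall g h : G, f (g, h) = a (section_pair hs g h)) /\
        phi (H2_class f) = Z1_class a.
Proof.
have [projP _ [s0 hs0]] := htau.
pose psi : {additive Z1 tau A -> H2 A} :=
  (\pi_(Quotient.quot (B2_pred (A := A))) \o section_cocycle hs0)%qT.
have [||phi [phi_bij phiE]] :=
    @quot_iso_of_surjective _ _ (eta_image (A := A)) psi.
- move=> q; have [a af] := section_cocycle_surjective hs0 (repr q) projP.
  by exists a; rewrite -[RHS]reprK; apply/H2_class_eq.
- move=> a; rewrite -(raddf0 \pi_(Quotient.quot (B2_pred (A := A)))%qT).
  split=> [/asboolP[c ac]|/H2_class_eq]; last first.
    by rewrite subr0 => /section_cocycle_trivial ac; apply/asboolP.
  by apply/H2_class_eq; rewrite subr0; exact: section_cocycle_eta ac.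
exists phi; split=> // s hs a; exists (section_cocycle hs a); split=> //.
rewrite /Z1_class -phiE; congr (phi _); apply/H2_class_eq.
exact: section_cocycle_indep.
Qed.
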